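(* Let $(R,\mathfrak m,K)$ be a (Noetherian) regular local ring of characteristic $p>0$ and dimension $d\geq 1$, and let $E=E(R/\mathfrak m)$ be the injective hull of the residue field, where $R$ and $E$ carry their standard $F_R$-module structures. Then $\mathrm{Ext}^1_{F_R}(R,E)\neq 0$. Moreover, when $K$ is infinite, $\mathrm{Ext}^1_{F_R}(R,E)$ is also infinite. In particular, $E$ is not injective in the category of $F_R$-modules.
   Context: Let $R^{(1)}$ denote $R$ regarded as an $R$-algebra via the Frobenius $r\mapsto r^p$. For an $R$-module $M$, $F(M)$ is the $R$-module obtained from $R^{(1)}\otimes_R M$ by identifying $R^{(1)}$ with $R$. An $F_R$-module is an $R$-module $M$ with an $R$-linear isomorphism $\theta:M\to F(M)$. A homomorphism $(M,\theta)\to(M',\theta')$ is an $R$-linear map $f$ with $\theta'\circ f=F(f)\circ\theta$. $F_R$-modules form an abelian category, and $\mathrm{Ext}^i_{F_R}$ denotes $\mathrm{Ext}$ in this category. A generating morphism of an $F_R$-module $M$ is an $R$-linear map $\beta:M_0\to F(M_0)$ such that $M=\varinjlim(M_0\xrightarrow{\beta}F(M_0)\xrightarrow{F(\beta)}F^2(M_0)\to\cdots)$ and $\theta$ is induced on the limit by the maps $F^e(\beta):F^e(M_0)\to F^{e+1}(M_0)$. Standard structures: on $R$, the structure isomorphism is the identity $R\to F(R)\cong R$, sending $1$ to $1$. On $E$, the structure is given by the generating morphism $\beta:R/\mathfrak m\to F(R/\mathfrak m)\cong R/(x_1^p,\dots,x_d^p)$, $\overline 1\mapsto\overline{x_1^{p-1}\cdots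 x_d^{p-1}}$, where $x_1,\dots,x_d$ are minimal generators of $\mathfrak m$. The limit module is isomorphic to $E$. *)

(* Defs.v *)
From HB Require Import structures.
From mathcomp Require Import all_boot all_algebra.
From mathcomp Require Import boolp classical_sets cardinality.

Set Implicit Arguments.
Unset Strict Implicit.
Unset Printing Implicit Defensive.

Import GRing.Theory.
Local Open Scope classical_set_scope.
Local Open Scope ring_scope.
Local Open Scope quotient_scope.

(* The predicates idealr, prime_idealr and submodClosed are Boolean-valued;
   with the classical axioms of boolp this is no restriction. An idealr is a
   proper ideal. *)

Definition ideal_span (R : comNzRingType) (n : nat) (x : 'I_n -> R) : set R :=
  [set y | exists c : 'I_n -> R, y = \sum_i c i * x i].

Definition generates_ideal (R : comNzRingType) (I : idealr R) (n : nat)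
    (x : 'I_n -> R) : Prop :=
  [set` I] = ideal_span x.

(* The improper ideal is generated by 1, so proper ideals suffice. *)
Definition noetherian (R : comNzRingType) : Prop :=
  forall I : idealr R, exists n (x : 'I_n -> R), generates_ideal I x.

Definition maximal_ideal (R : comNzRingType) (I : idealr R) : Prop :=
  forall J : idealr R, {subset I <= J} -> J =i I.

Definition local_ring (R : comNzRingType) (m : idealr R) : Prop :=
  maximal_ideal m /\ forall I : idealr R, maximal_ideal I -> I =i m.

Definition prime_chain (R : comNzRingType) (n : nat)
    (P : nat -> prime_idealr R) : Prop :=
  forall i, (i < n)%N ->
    {subset P i <= P i.+1} /\ ~ {subset P i.+1 <= P i}.

Definition krull_dim (R : comNzRingType) (d : nat) : Prop :=
  (exists P : nat -> prime_idealr R, prime_chain d P) /\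
  (forall n (P : nat -> prime_idealr R), prime_chain n P -> (n <= d)%N).

Definition regular_local_ring (R : comNzRingType) (m : idealr R) (d : nat)
    : Prop :=
  [/\ noetherian R, local_ring m, krull_dim R d &
      exists x : 'I_d -> R, generates_ideal m x].

(* The quotient ring R/I with its R-module structure *)
Section QuotientModule.
Variables (R : comNzRingType) (I : idealr R).
Local Notation Q := {ideal_quot I}.

Definition ideal_quot_scale (a : R) (x : Q) : Q := \pi a * x.

Lemma ideal_quot_scaleA a b x :
  ideal_quot_scale a (ideal_quot_scale b x) = ideal_quot_scale (a * b) x.
Proof. by rewrite /ideal_quot_scale mulrA rmorphM. Qed.

Lemma ideal_quot_scale1 : left_id 1 ideal_quot_scale.
Proof. by move=> x; rewrite /ideal_quot_scale rmorph1 mul1r. Qed.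

Lemma ideal_quot_scaleDr : right_distributive ideal_quot_scale +%R.
Proof. by move=> a x y; rewrite /ideal_quot_scale mulrDr. Qed.

Lemma ideal_quot_scaleDl x : {morph ideal_quot_scale^~ x : a b / a + b}.
Proof. by move=> a b; rewrite /ideal_quot_scale rmorphD mulrDl. Qed.

HB.instance Definition _ := GRing.Zmodule_isLmodule.Build R Q
  ideal_quot_scaleA ideal_quot_scale1 ideal_quot_scaleDr ideal_quot_scaleDl.
End QuotientModule.

Section InjectiveHull.
Variable R : comNzRingType.

Definition injective_module (E : lmodType R) : Prop :=
  forall (A B : lmodType R) (f : {linear A -> B}) (g : {linear A -> E}),
    injective f -> exists h : {linear B -> E}, forall a, h (f a) = g a.

Definition essential (K E : lmodType R) (i : {linear K -> E}) : Prop :=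
  forall N : submodClosed E, (exists2 z : E, z \in N & z != 0) ->
    exists2 k : K, i k \in N & i k != 0.

Definition injective_hull (K E : lmodType R) (i : {linear K -> E}) : Prop :=
  [/\ injective i, essential i & injective_module E].
End InjectiveHull.

(* Extension of scalars S (x)_R M along phi : R -> S. A formal sum of pure
   tensors s_1 (x) m_1 + ... + s_k (x) m_k is a list of pairs (s_i, m_i). *)
Section ExtensionOfScalars.
Variables (R S : comNzRingType) (phi : {rmorphism R -> S}).

Section Construction.
Variable M : lmodType R.

Inductive tensor_rel : seq (S * M) -> seq (S * M) -> Prop :=
| tensor_refl s : tensor_rel s s
| tensor_sym s t : tensor_rel s t -> tensor_rel t s
| tensor_trans s t u : tensor_rel s t -> tensor_rel t u -> tensor_rel s u
| tensor_cat s s' t t' :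
    tensor_rel s s' -> tensor_rel t t' -> tensor_rel (s ++ t) (s' ++ t')
| tensor_catC s t : tensor_rel (s ++ t) (t ++ s)
| tensor_0l m : tensor_rel [:: (0, m)] [::]
| tensor_Dl a b m : tensor_rel [:: (a + b, m)] [:: (a, m); (b, m)]
| tensor_Dr a m n : tensor_rel [:: (a, m + n)] [:: (a, m); (a, n)]
| tensor_balanced a r m : tensor_rel [:: (a, r *: m)] [:: (a * phi r, m)].

Definition tensor_relb (s t : seq (S * M)) : bool := `[< tensor_rel s t >].

Lemma tensor_relb_equiv : equiv_class_of tensor_relb.
Proof.
split=> [s|s t|t s u].
- exact/asboolP/tensor_refl.
- by apply/asboolP/asboolP; apply: tensor_sym.
- by move=> /asboolP st /asboolP tu; apply/asboolP/(tensor_trans st tu).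
Qed.
Canonical tensor_relb_equivRel := EquivRelPack tensor_relb_equiv.
Canonical tensor_relb_encModRel := defaultEncModRel tensor_relb.

Definition ext_scalars := {eq_quot tensor_relb}.
HB.instance Definition _ := Choice.on ext_scalars.
HB.instance Definition _ := EqQuotient.on ext_scalars.

Lemma ext_scalarsP s t : tensor_rel s t -> \pi_ext_scalars s = \pi_ext_scalars t.
Proof. by move=> st; apply/eqmodP/asboolP. Qed.

Lemma repr_ext_scalars s : tensor_rel (repr (\pi_ext_scalars s)) s.
Proof.
have /eqmodP : repr (\pi_ext_scalars s) = s %[mod ext_scalars].
  by rewrite reprK.
by move/asboolP.
Qed.

Definition ext_scalars_add (x y : ext_scalars) : ext_scalars :=
  \pi_ext_scalars (repr x ++ repr y).
Definition ext_scalars_scale (a : S) (x : ext_scalars) : ext_scalars :=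
  \pi_ext_scalars [seq (a * u.1, u.2) | u <- repr x].
Definition ext_scalars_opp (x : ext_scalars) : ext_scalars :=
  ext_scalars_scale (-1) x.

Lemma tensor_relZ a s t : tensor_rel s t ->
  tensor_rel [seq (a * u.1, u.2) | u <- s] [seq (a * u.1, u.2) | u <- t].
Proof.
elim=> /= [*|? ? _|? ? ? _ st _ tu|? ? ? ? _ ? _ ?|*|*|*|*|*].
- exact: tensor_refl.
- exact: tensor_sym.
- exact: tensor_trans st tu.
- by rewrite !map_cat; apply: tensor_cat.
- by rewrite !map_cat; apply: tensor_catC.
- by rewrite mulr0; apply: tensor_0l.
- by rewrite mulrDr; apply: tensor_Dl.
- exact: tensor_Dr.
- by rewrite mulrA; apply: tensor_balanced.
Qed.

Lemma ext_scalars_repr (x : ext_scalars) : exists s, x = \pi_ext_scalars s.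
Proof. by exists (repr x); rewrite reprK. Qed.

Lemma ext_scalars_addE s t :
  ext_scalars_add (\pi_ext_scalars s) (\pi_ext_scalars t) = \pi_ext_scalars (s ++ t).
Proof. by apply: ext_scalarsP; apply: tensor_cat; apply: repr_ext_scalars. Qed.

Lemma ext_scalars_scaleE a s :
  ext_scalars_scale a (\pi_ext_scalars s) = \pi_ext_scalars [seq (a * u.1, u.2) | u <- s].
Proof. exact/ext_scalarsP/tensor_relZ/repr_ext_scalars. Qed.

Lemma ext_scalars_addA : associative ext_scalars_add.
Proof.
move=> x y z; have [[s ->] [t ->] [u ->]] :=
  And3 (ext_scalars_repr x) (ext_scalars_repr y) (ext_scalars_repr z).
by rewrite !ext_scalars_addE catA.
Qed.

Lemma ext_scalars_addC : commutative ext_scalars_add.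
Proof. by move=> x y; apply/ext_scalarsP/tensor_catC. Qed.

Lemma ext_scalars_add0 : left_id (\pi_ext_scalars [::]) ext_scalars_add.
Proof. by move=> x; have [s ->] := ext_scalars_repr x; rewrite ext_scalars_addE. Qed.

Lemma ext_scalars_scaleDl x a b :
  ext_scalars_scale (a + b) x =
  ext_scalars_add (ext_scalars_scale a x) (ext_scalars_scale b x).
Proof.
have [r ->] := ext_scalars_repr x.
rewrite !ext_scalars_scaleE ext_scalars_addE; apply: ext_scalarsP.
elim: r => [|[s m] t IHt] /=; first exact: tensor_refl.
rewrite mulrDl; set t1 := [seq (a * u.1, u.2) | u <- t].
set t2 := [seq (b * u.1, u.2) | u <- t].
apply: (tensor_trans (t := [:: (a * s, m); (b * s, m)] ++ (t1 ++ t2))).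
  exact: (tensor_cat (tensor_Dl (a * s) (b * s) m) IHt).
have := tensor_cat (tensor_refl [:: (a * s, m)])
  (tensor_cat (tensor_catC [:: (b * s, m)] t1) (tensor_refl t2)).
by rewrite -!catA.
Qed.

Lemma ext_scalars_scale0 x : ext_scalars_scale 0 x = \pi_ext_scalars [::].
Proof.
have [r ->] := ext_scalars_repr x.
rewrite ext_scalars_scaleE; apply: ext_scalarsP.
elim: r => [|[s m] t IHt] /=; first exact: tensor_refl.
by rewrite mul0r; apply: (tensor_cat (tensor_0l m) IHt).
Qed.

Lemma ext_scalars_scale1 : left_id 1 ext_scalars_scale.
Proof.
move=> x; have [r ->] := ext_scalars_repr x.
rewrite ext_scalars_scaleE; congr (\pi_ext_scalars _).
by rewrite -[RHS]map_id; apply: eq_map => -[s m] /=; rewrite mul1r.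
Qed.

Lemma ext_scalars_addN :
  left_inverse (\pi_ext_scalars [::]) ext_scalars_opp ext_scalars_add.
Proof.
move=> x; rewrite -{2}[x]ext_scalars_scale1 -ext_scalars_scaleDl addNr.
exact: ext_scalars_scale0.
Qed.

HB.instance Definition _ := GRing.isZmodule.Build ext_scalars
  ext_scalars_addA ext_scalars_addC ext_scalars_add0 ext_scalars_addN.

Lemma ext_scalars_scaleA a b x :
  ext_scalars_scale a (ext_scalars_scale b x) = ext_scalars_scale (a * b) x.
Proof.
have [r ->] := ext_scalars_repr x.
rewrite !ext_scalars_scaleE -map_comp; congr (\pi_ext_scalars _).
by apply: eq_map => u /=; rewrite mulrA.
Qed.

Lemma ext_scalars_scaleDr : right_distributive ext_scalars_scale +%R.
Proof.
move=> a x y.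
have [[s ->] [t ->]] := conj (ext_scalars_repr x) (ext_scalars_repr y).
by rewrite [in LHS]/GRing.add /= ext_scalars_addE !ext_scalars_scaleE map_cat
           -ext_scalars_addE.
Qed.

HB.instance Definition _ := GRing.Zmodule_isLmodule.Build S ext_scalars
  ext_scalars_scaleA ext_scalars_scale1 ext_scalars_scaleDr ext_scalars_scaleDl.

(* m |-> 1 (x) m; the pure tensor s (x) m is s *: tensor1 m. *)
Definition tensor1 (m : M) : ext_scalars := \pi_ext_scalars [:: (1, m)].

Lemma tensor1_is_linear : linear_for (phi \; *:%R) tensor1.
Proof.
move=> r m n; have -> : (phi \; *:%R) r (tensor1 m) = \pi_ext_scalars [:: (1 * phi r, m)].
  rewrite /= [LHS]/GRing.scale /= ext_scalars_scaleE /= mulr1.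
  by rewrite mul1r.
rewrite [RHS]/GRing.add /= ext_scalars_addE; apply: ext_scalarsP.
apply: (tensor_trans (tensor_Dr _ _ _)); rewrite -cat1s.
by apply: tensor_cat; [exact: tensor_balanced | exact: tensor_refl].
Qed.
HB.instance Definition _ :=
  GRing.isLinear.Build R M ext_scalars (phi \; *:%R) tensor1 tensor1_is_linear.

Lemma ext_scalars_sum (s : seq (S * M)) :
  \pi_ext_scalars s = \sum_(u <- s) u.1 *: tensor1 u.2.
Proof.
elim: s => [|[a m] s IHs]; first by rewrite big_nil.
rewrite big_cons -IHs /tensor1 /= [X in X + _]/GRing.scale /=.
by rewrite ext_scalars_scaleE /= mulr1 [RHS]/GRing.add /= ext_scalars_addE.
Qed.

Section Lift.
Variables (W : lmodType S) (g : {linear M -> W | phi \; *:%R}).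

(* s (x) m |-> s *: g m *)
Definition ext_scalars_lift (x : ext_scalars) : W :=
  \sum_(u <- repr x) u.1 *: g u.2.

Lemma tensor_rel_sum s t : tensor_rel s t ->
  \sum_(u <- s) u.1 *: g u.2 = \sum_(u <- t) u.1 *: g u.2.
Proof.
elim=> {s t}.
- by [].
- by [].
- by move=> s t u _ -> _ ->.
- by move=> s s' t t' _ ss' _ tt'; rewrite !big_cat /= ss' tt'.
- by move=> s t; rewrite !big_cat /= addrC.
- by move=> m; rewrite big_seq1 big_nil scale0r.
- by move=> a b m; rewrite !(big_cons, big_nil) !addr0 scalerDl.
- by move=> a m n; rewrite !(big_cons, big_nil) !addr0 linearD scalerDr.
- by move=> a r m; rewrite !big_seq1 linearZ_LR /= scalerA.
Qed.

Lemma ext_scalars_liftE s :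
  ext_scalars_lift (\pi_ext_scalars s) = \sum_(u <- s) u.1 *: g u.2.
Proof.
exact/tensor_rel_sum/repr_ext_scalars.
Qed.

Lemma ext_scalars_lift_is_linear : linear ext_scalars_lift.
Proof.
move=> a x y.
have [[s ->] [t ->]] := conj (ext_scalars_repr x) (ext_scalars_repr y).
rewrite [X in ext_scalars_lift (X + _)]/GRing.scale /= ext_scalars_scaleE.
rewrite [X in ext_scalars_lift X]/GRing.add /= ext_scalars_addE.
rewrite !ext_scalars_liftE big_cat big_map scaler_sumr; congr (_ + _).
by apply: eq_bigr => u _; rewrite scalerA.
Qed.
HB.instance Definition _ := GRing.isLinear.Build S ext_scalars W *:%R
  ext_scalars_lift ext_scalars_lift_is_linear.

Lemma ext_scalars_lift1 m : ext_scalars_lift (tensor1 m) = g m.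
Proof. by rewrite /tensor1 ext_scalars_liftE big_seq1 scale1r. Qed.
End Lift.

Lemma ext_scalars_linear_ext (W : lmodType S) (f g : {linear ext_scalars -> W}) :
  (forall m, f (tensor1 m) = g (tensor1 m)) -> f =1 g.
Proof.
move=> fg x; have [s ->] := ext_scalars_repr x; rewrite ext_scalars_sum !linear_sum.
by apply: eq_bigr => u _; rewrite !linearZ /= fg.
Qed.
End Construction.

Definition ext_scalars_map (M N : lmodType R) (f : {linear M -> N}) :
    {linear ext_scalars M -> ext_scalars N} :=
  ext_scalars_lift (@tensor1 N \o f).

Lemma ext_scalars_map1 (M N : lmodType R) (f : {linear M -> N}) m :
  ext_scalars_map f (tensor1 m) = tensor1 (f m).
Proof. exact: ext_scalars_lift1. Qed.

Lemma ext_scalars_map_id (M : lmodType R) (f : {linear M -> M}) :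
  f =1 id -> ext_scalars_map f =1 id.
Proof.
move=> f1; apply: (ext_scalars_linear_ext (g := idfun)) => m /=.
by rewrite ext_scalars_map1 f1.
Qed.

Lemma ext_scalars_map_comp (M N P : lmodType R)
    (f : {linear M -> N}) (g : {linear N -> P}) (h : {linear M -> P}) :
  (forall m, h m = g (f m)) ->
  forall x, ext_scalars_map h x = ext_scalars_map g (ext_scalars_map f x).
Proof.
move=> hE; apply: (ext_scalars_linear_ext
  (g := ext_scalars_map g \o ext_scalars_map f)) => m /=.
by rewrite !ext_scalars_map1 hE.
Qed.

Lemma ext_scalars_mapD (M N : lmodType R) (f g h : {linear M -> N}) :
  (forall m, h m = f m + g m) ->
  forall x, ext_scalars_map h x = ext_scalars_map f x + ext_scalars_map g x.
Proof.
move=> hE; apply: (ext_scalars_linear_ext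
  (g := ext_scalars_map f \+ ext_scalars_map g)) => m /=.
by rewrite !ext_scalars_map1 hE linearD.
Qed.

End ExtensionOfScalars.

(* infinite_set [set: T] at all universe levels *)
Definition infinite (T : Type) : Prop :=
  ~ exists n (f : 'I_n -> T), forall y, exists i, f i = y.

Section FModules.
Variables (R : comNzRingType) (p : nat) (pcharRp : p \in [pchar R]).

(* R^(1) is R viewed as an R-algebra through pFrobenius_aut pcharRp. *)
Definition Fobj (M : lmodType R) : lmodType R :=
  ext_scalars (pFrobenius_aut pcharRp) M.

Definition Fpure (M : lmodType R) (m : M) : Fobj M :=
  tensor1 (pFrobenius_aut pcharRp) m.

Definition Fmap (M N : lmodType R) (f : {linear M -> N}) :
    {linear Fobj M -> Fobj N} :=
  ext_scalars_map (pFrobenius_aut pcharRp) f.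

Record Fmodule := FModule {
  Fcarrier :> lmodType R;
  Fstruct : {linear Fcarrier -> Fobj Fcarrier};
  Fstruct_bij : bijective Fstruct }.

Record Fhom (M N : Fmodule) := FHom {
  Fhom_linear :> {linear M -> N};
  FhomP : forall x, Fstruct N (Fhom_linear x) = Fmap Fhom_linear (Fstruct M x) }.

Lemma Fhom_id_subproof (M : Fmodule) x :
  Fstruct M x = Fmap (idfun : {linear M -> M}) (Fstruct M x).
Proof. by rewrite /Fmap ext_scalars_map_id. Qed.
Definition Fhom_id (M : Fmodule) : Fhom M M :=
  @FHom M M idfun (@Fhom_id_subproof M).

Lemma Fhom_comp_subproof (M N P : Fmodule) (g : Fhom N P) (f : Fhom M N) x :
  Fstruct P (g (f x)) = Fmap (g \o f : {linear M -> P}) (Fstruct M x).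
Proof.
by rewrite !FhomP /Fmap (@ext_scalars_map_comp _ _ _ _ _ _ f g (g \o f)).
Qed.
Definition Fhom_comp (M N P : Fmodule) (g : Fhom N P) (f : Fhom M N) :
    Fhom M P :=
  @FHom M P (g \o f) (Fhom_comp_subproof g f).

Lemma Fhom_inv (M N : Fmodule) (f : Fhom M N) : bijective f ->
  exists2 g : Fhom N M, cancel f g & cancel g f.
Proof.
case=> g fK gK.
have g_lin : linear g by move=> a x y; apply: (can_inj fK); rewrite linearP !gK.
pose gL : {linear N -> M} :=
  HB.pack_for {linear N -> M} g (GRing.isLinear.Build _ _ _ _ g g_lin).
have gP x : Fstruct M (gL x) = Fmap gL (Fstruct N x).
  rewrite -{2}[x]gK FhomP /Fmap.
  rewrite -(@ext_scalars_map_comp _ _ _ _ _ _ f gL idfun).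
    by rewrite ext_scalars_map_id.
  by move=> m /=; rewrite fK.
by exists (FHom gP).
Qed.

(* Kernels and cokernels of homomorphisms of F_R-modules are those of the
   underlying modules (Frobenius is flat on a regular ring), so exactness and
   monomorphisms are tested on underlying modules. *)
Definition Finjective (E : Fmodule) : Prop :=
  forall (A B : Fmodule) (f : Fhom A B) (g : Fhom A E),
    injective f -> exists h : Fhom B E, forall a, h (f a) = g a.

(* Yoneda Ext^1(M, N): classes of exact sequences 0 -> N -> X -> M -> 0 *)
Section Ext1.
Variables M N : Fmodule.

Record extension := Extension {
  ext_mid : Fmodule;
  ext_inc : Fhom N ext_mid;
  ext_prj : Fhom ext_mid M;
  ext_inc_inj : injective ext_inc;
  ext_prj_surj : forall y, exists x, ext_prj x = y;
  ext_exact : forall x, ext_prj x = 0 <-> exists y, x = ext_inc y }.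

Definition ext_equiv (X Y : extension) : Prop :=
  exists f : Fhom (ext_mid X) (ext_mid Y),
    (forall y, f (ext_inc X y) = ext_inc Y y) /\
    (forall x, ext_prj Y (f x) = ext_prj X x).

Lemma ext_equiv_sym X Y : ext_equiv X Y -> ext_equiv Y X.
Proof.
case=> f [fi fp].
have f_inj : injective f.
  apply: raddf_inj => x fx0.
  have /ext_exact [y xE] : ext_prj X x = 0 by rewrite -fp -[RHS](linear0 (ext_prj Y)) -fx0.
  suff y0 : y = 0 by rewrite xE y0 linear0.
  by apply: (@ext_inc_inj Y); rewrite linear0 -fi -xE.
have f_surj y : exists x, f x = y.
  have [x0 x0E] := ext_prj_surj X (ext_prj Y y).
  have /ext_exact [z zE] : ext_prj Y (y - f x0) = 0.
    by rewrite linearB fp x0E subrr.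
  exists (x0 + ext_inc X z); rewrite linearD fi -zE.
  by rewrite addrC subrK.
have [f' f'E] := choice f_surj.
have f_bij : bijective f by exists f' => // x; apply: f_inj.
have [g fK gK] := Fhom_inv f_bij.
exists g; split=> [y|x]; first by rewrite -fi fK.
by rewrite -fp gK.
Qed.

Lemma ext_equiv_refl X : ext_equiv X X.
Proof. by exists (Fhom_id _). Qed.

Lemma ext_equiv_trans X Y Z :
  ext_equiv X Y -> ext_equiv Y Z -> ext_equiv X Z.
Proof.
case=> f [fi fp] [g [gi gp]]; exists (Fhom_comp g f).
by split=> x /=; [rewrite fi gi | rewrite gp fp].
Qed.

(* eq_quot and set are unavailable: extensions live in a universe above that of
   the carriers of choiceType. *)
Definition Ext1 :=
  {C : extension -> Prop | exists X, C = ext_equiv X}.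

Definition Ext1_class (X : extension) : Ext1 :=
  exist _ (ext_equiv X) (ex_intro _ X erefl).

Lemma Ext1_classP (X Y : extension) :
  Ext1_class X = Ext1_class Y <-> ext_equiv X Y.
Proof.
split=> [/(congr1 (@sval _ _)) /= XY|XY].
  by rewrite XY; apply: ext_equiv_refl.
apply: eq_exist; apply: funext => Z; apply/propext; split=> [XZ|].
  exact: ext_equiv_trans (ext_equiv_sym XY) XZ.
exact: ext_equiv_trans XY.
Qed.

Lemma Ext1_class_surj (c : Ext1) : exists X, c = Ext1_class X.
Proof. by case: c => C [X CE]; exists X; apply: eq_exist. Qed.

(* The split extension 0 -> N -> N (+) M -> M -> 0 *)
Definition inl_sum (y : N) : N * M := (y, 0).
Definition inr_sum (x : M) : N * M := (0, x).

Lemma inl_sum_is_linear : linear inl_sum.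
Proof. by move=> a x y; congr (_, _); rewrite /= scaler0 addr0. Qed.
HB.instance Definition _ :=
  GRing.isLinear.Build R N (N * M)%type *:%R inl_sum inl_sum_is_linear.

Lemma inr_sum_is_linear : linear inr_sum.
Proof. by move=> a x y; congr (_, _); rewrite /= scaler0 addr0. Qed.
HB.instance Definition _ :=
  GRing.isLinear.Build R M (N * M)%type *:%R inr_sum inr_sum_is_linear.

Definition sum_struct (u : N * M) : Fobj (N * M)%type :=
  Fmap inl_sum (Fstruct N u.1) + Fmap inr_sum (Fstruct M u.2).

Lemma sum_struct_is_linear : linear sum_struct.
Proof.
move=> a u v; rewrite /sum_struct /= !linearP scalerDr.
by rewrite addrACA.
Qed.
HB.instance Definition _ := GRing.isLinear.Build R (N * M)%type
  (Fobj (N * M)%type) *:%R sum_struct sum_struct_is_linear.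

Lemma Fmap_fst_sum u : Fmap fst (sum_struct u) = Fstruct N u.1.
Proof.
rewrite /sum_struct linearD /Fmap.
rewrite -(@ext_scalars_map_comp _ _ _ _ _ _ inl_sum fst idfun) //.
rewrite -(@ext_scalars_map_comp _ _ _ _ _ _ inr_sum fst \0) //.
rewrite ext_scalars_map_id //.
suff -> : ext_scalars_map (pFrobenius_aut pcharRp) (\0 : {linear M -> N})
            (Fstruct M u.2) = 0 by rewrite addr0.
have := @ext_scalars_mapD _ _ (pFrobenius_aut pcharRp) M N \0 \0 \0.
by move=> /(_ (fun=> esym (addr0 _))) /(_ (Fstruct M u.2)) /eqP;
  rewrite -subr_eq subrr => /eqP.
Qed.

Lemma Fmap_snd_sum u : Fmap snd (sum_struct u) = Fstruct M u.2.
Proof.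
rewrite /sum_struct linearD /Fmap.
rewrite -(@ext_scalars_map_comp _ _ _ _ _ _ inr_sum snd idfun) //.
rewrite -(@ext_scalars_map_comp _ _ _ _ _ _ inl_sum snd \0) //.
rewrite [X in _ + X]ext_scalars_map_id //.
suff -> : ext_scalars_map (pFrobenius_aut pcharRp) (\0 : {linear N -> M})
            (Fstruct N u.1) = 0 by rewrite add0r.
have := @ext_scalars_mapD _ _ (pFrobenius_aut pcharRp) N M \0 \0 \0.
by move=> /(_ (fun=> esym (addr0 _))) /(_ (Fstruct N u.1)) /eqP;
  rewrite -subr_eq subrr => /eqP.
Qed.

Lemma sum_struct_bij : bijective sum_struct.
Proof.
have [tN tNK tNK'] := Fstruct_bij N; have [tM tMK tMK'] := Fstruct_bij M.
exists (fun w => (tN (Fmap fst w), tM (Fmap snd w))) => [[y x]|w].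
  by rewrite Fmap_fst_sum Fmap_snd_sum tNK tMK.
rewrite /sum_struct /= tNK' tMK' /Fmap.
rewrite -(@ext_scalars_map_comp _ _ _ _ _ _ fst inl_sum (inl_sum \o fst)) //.
rewrite -(@ext_scalars_map_comp _ _ _ _ _ _ snd inr_sum (inr_sum \o snd)) //.
rewrite -(@ext_scalars_mapD _ _ _ _ _ (inl_sum \o fst) (inr_sum \o snd) idfun).
  by rewrite ext_scalars_map_id.
by case=> y x /=; congr (_, _); rewrite /= ?addr0 ?add0r.
Qed.

Definition sum_Fmodule : Fmodule := @FModule (N * M)%type sum_struct sum_struct_bij.

Lemma sum_inl_subproof y : sum_struct (inl_sum y) = Fmap inl_sum (Fstruct N y).
Proof. by rewrite /sum_struct /= !linear0 addr0. Qed.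
Definition sum_inl : Fhom N sum_Fmodule :=
  @FHom N sum_Fmodule inl_sum sum_inl_subproof.

Definition sum_snd : Fhom sum_Fmodule M :=
  @FHom sum_Fmodule M snd (fun u => esym (Fmap_snd_sum u)).

Lemma sum_inl_inj : injective sum_inl.
Proof. by move=> x y []. Qed.

Lemma sum_snd_surj y : exists x, sum_snd x = y.
Proof. by exists (0, y). Qed.

Lemma sum_exact x : sum_snd x = 0 <-> exists y, x = sum_inl y.
Proof.
split=> [|[y ->] //]; case: x => y x /= ->; by exists y.
Qed.

Definition split_extension : extension :=
  Extension sum_inl_inj sum_snd_surj sum_exact.

(* The zero element of the group Ext^1(M, N) *)
Definition Ext1_zero : Ext1 := Ext1_class split_extension.
End Ext1.

(* R -> F(R), r |-> r (x) 1; under F(R) = R this is the identity. *)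
Definition R_struct (r : R^o) : Fobj R^o := r *: Fpure (1 : R^o).

Lemma R_struct_is_linear : linear R_struct.
Proof. by move=> a r s; rewrite /R_struct scalerDl -scalerA. Qed.
HB.instance Definition _ :=
  GRing.isLinear.Build R R^o (Fobj R^o) *:%R R_struct R_struct_is_linear.

Lemma R_struct_bij : bijective R_struct.
Proof.
have frob_lin :
  linear_for (pFrobenius_aut pcharRp \; *:%R) (pFrobenius_aut pcharRp : R^o -> R^o).
  by move=> a x y; rewrite rmorphD rmorphM.
pose frob : {linear R^o -> R^o | pFrobenius_aut pcharRp \; *:%R} :=
  HB.pack_for {linear R^o -> R^o | pFrobenius_aut pcharRp \; *:%R}
    (pFrobenius_aut pcharRp : R^o -> R^o)
    (GRing.isLinear.Build R R^o R^o _ _ frob_lin).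
exists (ext_scalars_lift frob) => [r|x].
  by rewrite /R_struct linearZ /= ext_scalars_lift1 /= rmorph1 [_ *: _]mulr1.
apply: (ext_scalars_linear_ext
  (f := R_struct \o ext_scalars_lift frob) (g := idfun)) x => r /=.
rewrite ext_scalars_lift1 /R_struct /=.
rewrite -[X in _ = tensor1 _ X]mulr1.
by rewrite [RHS](linearZ_LR (tensor1 (pFrobenius_aut pcharRp) (M := R^o)) r 1).
Qed.

Definition R_Fmodule : Fmodule := @FModule R^o R_struct R_struct_bij.

Definition Fiter (e : nat) (M : lmodType R) : lmodType R := iter e Fobj M.

(* F^e(beta) : F^e(M0) -> F^(e+1)(M0) *)
Fixpoint Fiter_map (M0 : lmodType R) (beta : {linear M0 -> Fobj M0}) (e : nat) :
    {linear Fiter e M0 -> Fiter e.+1 M0} :=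
  match e with
  | 0 => beta
  | e'.+1 => Fmap (Fiter_map beta e')
  end.

Definition is_direct_limit (X : nat -> lmodType R)
    (t : forall e, {linear X e -> X e.+1})
    (L : lmodType R) (i : forall e, {linear X e -> L}) : Prop :=
  (forall e x, i e.+1 (t e x) = i e x) /\
  (forall (W : lmodType R) (g : forall e, {linear X e -> W}),
     (forall e x, g e.+1 (t e x) = g e x) ->
     exists h : {linear L -> W}, (forall e x, h (i e x) = g e x) /\
       forall h' : {linear L -> W}, (forall e x, h' (i e x) = g e x) -> h' =1 h).

(* The structure map of M = lim F^e(M0) is induced by the maps
   F^e(beta) : F^e(M0) -> F^(e+1)(M0) = F(F^e(M0)). *)
Definition generating_morphism (M0 : lmodType R)
    (beta : {linear M0 -> Fobj M0}) (M : Fmodule) : Prop :=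
  exists i : forall e, {linear Fiter e M0 -> M},
    is_direct_limit (Fiter_map beta) i /\
    (forall e x, Fstruct M (i e x) = Fmap (i e) (Fiter_map beta e x)).

(* When d = dim R, any x_1, ..., x_d generating m are minimal generators.
   Under F(R/m) = R/(x_1^p, ..., x_d^p) the class of r is r (x) 1. *)
Definition standard_generator (m : idealr R) (d : nat) (x : 'I_d -> R)
    (beta : {linear {ideal_quot m} -> Fobj {ideal_quot m}}) : Prop :=
  beta 1 = (\prod_i x i ^+ p.-1) *: Fpure (1 : {ideal_quot m}).

End FModules.

(* Main.v *)
Require Import Defs.
From HB Require Import structures.
From mathcomp Require Import all_boot all_algebra.
From mathcomp Require Import boolp.

Set Implicit Arguments.
Unset Strict Implicit.
Unset Printing Implicit Defensive.

Import GRing.Theory.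
Local Open Scope ring_scope.
Local Open Scope quotient_scope.

(** Write theta for the structure isomorphism of E and phi for its Frobenius
    action z |-> theta^-1 (1 (x) z), which is additive and satisfies
    phi (a z) = a^p (phi z).

    Every w in E gives an extension of R by E: the module E (+) R with the direct
    sum structure precomposed with the shear (e, r) |-> (e + r w, r)
    [extension_of_R]. An equivalence between the extensions of v and of w sends
    (0, 1) to some (z, 1), and comparing structures there gives
    z - phi z = v - w [extension_of_R_equiv]; so a subgroup of E that meets the
    image of 1 - phi only in 0 embeds in Ext^1(R, E). The socle of E is such a
    subgroup. Let u be the image in E of 1 in the first term R/m of the direct
    system defining E, and let x be the product of the x_i.

    - u is nonzero, because otherwise the whole direct system maps to 0
      [generating_morphism_neq0]; so R/m embeds in E as R u, and by essentiality
      every nonzero z has a multiple equal to u [essential_socle].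
    - The generating morphism says that u = x^(p-1) (phi u).
    - Every z is killed by all x_i^(p^e) for e large, as F^e(R/m) is
      [generating_morphism_nilpotent].

    From the first two facts, if x_i (phi z) = 0 for one i, or if phi z = 0, then
    z = 0: otherwise s z = u for some s, and u = x^(p-1) s^p (phi z) = 0.
    Now let z - phi z be in the socle. Then x_i^n z = x_i^n (phi z) for n > 0, so
    if all x_i^(p^(e+1)) kill z, they kill phi z, hence phi kills x_i^(p^e) z, and
    all x_i^(p^e) kill z. Descending to e = 0 gives x_i z = 0 = x_i (phi z), so
    z = 0 [sub_Frobenius_socle].

    Hence distinct elements of R/m give distinct classes in Ext^1(R, E), which is
    therefore nonzero, and infinite if R/m is. An injective E would split every
    extension [Finjective_Ext1]. *)

(** * Submodules given by propositions *)

Definition submodule_prop (R : comNzRingType) (V : lmodType R) (P : V -> Prop) :=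
  [/\ P 0, forall u v, P u -> P v -> P (u + v) & forall a v, P v -> P (a *: v)].

Section Submodule.
Variables (R : comNzRingType) (V : lmodType R) (P : V -> Prop).
Hypothesis P_sub : submodule_prop P.

Definition submodule_pred (v : V) : bool := `[< P v >].

Lemma submodule_pred_closed : subsemimod_closed submodule_pred.
Proof.
case: P_sub => P0 PD PZ; split; first split.
- exact/asboolP.
- by move=> u v /asboolP Pu /asboolP Pv; apply/asboolP/PD.
- by move=> a v /asboolP Pv; apply/asboolP/PZ.
Qed.

Definition submodule : submodClosed V :=
  HB.pack_for (submodClosed V) submodule_pred
    (GRing.isSubSemiModClosed.Build R V submodule_pred submodule_pred_closed).

Lemma in_submodule v : (v \in submodule) <-> P v.
Proof. by split=> /asboolP. Qed.

Record submodule_type := SubmoduleType {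
  submodule_val :> V; _ : submodule_val \in submodule }.
HB.instance Definition _ := [isSub for submodule_val].
HB.instance Definition _ := [Choice of submodule_type by <:].
HB.instance Definition _ := [SubChoice_isSubLmodule of submodule_type by <:].
End Submodule.

(** Corestrict the maps of the cocone to the submodule cut out by P: the induced
    map, followed by the inclusion, agrees with the identity on the cocone, hence
    is the identity. *)
Lemma direct_limit_ind (R : comNzRingType) (X : nat -> lmodType R)
    (t : forall e, {linear X e -> X e.+1}) (L : lmodType R)
    (i : forall e, {linear X e -> L}) (P : L -> Prop) :
  is_direct_limit t i -> submodule_prop P -> (forall e y, P (i e y)) ->
  forall z, P z.
Proof.
move=> [it univ] P_sub Pi z.
pose W : lmodType R := submodule_type P_sub.
have iP e y : i e y \in submodule P_sub by apply/in_submodule/Pi.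
pose j e y : W := SubmoduleType (iP e y).
have j_lin e : linear (j e).
  by move=> a u v; apply: val_inj; rewrite /= linearP.
pose jL e : {linear X e -> W} := HB.pack_for {linear X e -> W} (j e)
  (GRing.isLinear.Build _ _ _ _ (j e) (j_lin e)).
have [|h [hj _]] := univ W jL; first by move=> e y; apply: val_inj; rewrite /= it.
have [k [_ k_uniq]] := univ L i it.
have id_k : (idfun : {linear L -> L}) =1 k by apply: k_uniq.
have h_k : (val \o h : {linear L -> L}) =1 k.
  by apply: k_uniq => e y /=; rewrite hj.
have -> : z = val (h z) by rewrite -[LHS]/(idfun z) id_k -h_k.
exact/in_submodule/(valP (h z)).
Qed.

(** * The residue field *)

Section ResidueField.
Variables (R : comNzRingType) (m : idealr R).
Local Notation K := {ideal_quot m}.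

Lemma ideal_quot_eq0 (a : R) : (\pi_K a == 0 :> K) = (a \in m).
Proof. by rewrite -(rmorph0 \pi_K) -Quotient.idealrBE subr0. Qed.

Lemma ideal_quot_scaler1 (a : R) : a *: (1 : K) = \pi_K a.
Proof. by rewrite [LHS]mulr1. Qed.

Lemma ideal_quot_gen (k : K) : repr k *: (1 : K) = k.
Proof. by rewrite ideal_quot_scaler1 reprK. Qed.

(** The ideal m + Ra is proper unless it contains 1. *)
Lemma maximal_ideal_inv (a : R) :
  maximal_ideal m -> a \notin m -> exists b, 1 - b * a \in m.
Proof.
move=> m_max am; apply: contrapT => no_inv.
pose J : R -> bool := fun y => `[< exists b, y - b * a \in m >].
have J_ideal : idealr_closed J.
  split.
  - by apply/asboolP; exists 0; rewrite mul0r subr0 idealr0.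
  - exact/asboolP.
  - move=> c u v /asboolP [bu bum] /asboolP [bv bvm]; apply/asboolP.
    exists (c * bu + bv); rewrite mulrDl -mulrA opprD addrACA -mulrBr.
    by rewrite rpredD // idealMr.
pose JI : idealr R := HB.pack_for (idealr R) J (isIdealr.Build R J J_ideal).
have aJ : a \in JI by apply/asboolP; exists 1; rewrite mul1r subrr idealr0.
move: am; rewrite -(m_max JI) ?aJ // => y ym.
by apply/asboolP; exists 0; rewrite mul0r subr0.
Qed.

Lemma ideal_quot_inv (k : K) :
  maximal_ideal m -> k != 0 -> exists s : R, s *: k = 1.
Proof.
move=> m_max; rewrite -{1}[k]reprK ideal_quot_eq0.
move=> /(maximal_ideal_inv m_max) [b bk]; exists b.
rewrite -[k]ideal_quot_gen scalerA ideal_quot_scaler1; apply/esym/eqP.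
by rewrite -subr_eq0 -(rmorph1 \pi_K) -rmorphB ideal_quot_eq0.
Qed.

Lemma ideal_quot_linear_inj (V : lmodType R) (f : {linear K -> V}) :
  maximal_ideal m -> f 1 != 0 -> forall k, f k = 0 -> k = 0.
Proof.
move=> m_max f1 k fk0; apply/eqP; apply: contraNT f1 => k0.
by have [s <-] := ideal_quot_inv m_max k0; rewrite linearZ /= fk0 scaler0.
Qed.

(** By essentiality Rz meets the image of the residue field K, and a nonzero
    element of K generates K; in particular this applies to z = u, so that u is
    a unit multiple of the image of 1. *)
Lemma essential_socle (V : lmodType R) (iota : {linear K -> V}) (u : V) :
  maximal_ideal m -> essential iota -> u != 0 ->
  (forall a, a \in m -> a *: u = 0) ->
  forall z, z != 0 -> exists s, s *: z = u.
Proof.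
move=> m_max iota_ess u0 mu.
have to_iota1 z : z != 0 -> iota 1 != 0 /\ exists s, s *: z = iota 1.
  move=> z0; pose P (y : V) := exists s : R, y = s *: z.
  have P_sub : submodule_prop P.
    split; first by exists 0; rewrite scale0r.
    - by move=> _ _ [s ->] [t ->]; exists (s + t); rewrite scalerDl.
    - by move=> a _ [s ->]; exists (a * s); rewrite scalerA.
  have [|k /in_submodule [s ks] k0] := iota_ess (submodule P_sub).
    by exists z => //; apply/in_submodule; exists 1; rewrite scale1r.
  split.
    apply: contraNneq k0 => iota10.
    by rewrite -[k]ideal_quot_gen linearZ /= iota10 scaler0.
  have k_ne0 : k != 0 by apply: contraNneq k0 => ->; rewrite linear0.
  have [t tk] := ideal_quot_inv m_max k_ne0.
  by exists (t * s); rewrite -tk linearZ /= ks scalerA.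
move=> z /to_iota1 [iota1 [s sz]]; have [_ [t tu]] := to_iota1 u u0.
have tm : t \notin m by apply: contra_neqN iota1 => /mu; rewrite tu.
have [b bt] := maximal_ideal_inv m_max tm.
exists (b * s); rewrite -scalerA sz -tu scalerA.
by apply/eqP; rewrite eq_sym -subr_eq0 -{1}[u]scale1r -scalerBl mu.
Qed.
End ResidueField.

Lemma generator_in_ideal (R : comNzRingType) (I : idealr R) n (x : 'I_n -> R) i :
  generates_ideal I x -> x i \in I.
Proof.
move=> I_gen; have : ideal_span x (x i); last by rewrite -I_gen.
exists (fun j => (j == i)%:R); rewrite (bigD1 i) //= eqxx mul1r big1 ?addr0 //.
by move=> j /negPf ->; rewrite mul0r.
Qed.

(** * Frobenius actions *)

(** No nonzero element of the socle is of the form z - phi z: if x_i ^ (p ^ e.+1)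
    kills z then it kills phi z, that is, phi kills x_i ^ (p ^ e) *: z, and phi is
    injective; so the exponent descends until every x_i kills z and phi z. *)
Lemma sub_Frobenius_socle (R : comNzRingType) (V : lmodType R) (p : nat)
    (phi : V -> V) (d : nat) (x : 'I_d -> R) (u : V) :
  (1 < p)%N -> (0 < d)%N ->
  phi 0 = 0 -> (forall (a : R) (z : V), phi (a *: z) = a ^+ p *: phi z) ->
  u != 0 -> (forall z : V, z != 0 -> exists s : R, s *: z = u) ->
  (\prod_i x i ^+ p.-1) *: phi u = u ->
  (forall z : V, exists e, forall i, x i ^+ (p ^ e) *: z = 0) ->
  forall z : V, (forall i, x i *: (z - phi z) = 0) -> z = 0.
Proof.
move=> p_gt1 d_gt0 phi0 phiZ u0 u_ess phiu x_nil z xw.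
(* A nonzero y has a multiple u, and phi u is nonzero. *)
have phi_eq0 y : phi y = 0 -> y = 0.
  move=> phiy; apply/eqP; apply: contraNT u0 => /u_ess [s su].
  by rewrite -phiu -su phiZ phiy !scaler0.
(* As p > 1, each x i divides the multiplier of phi u. *)
have x_kill i : x i *: phi z = 0 -> z = 0.
  move=> xphi; apply/eqP; apply: contraNT u0 => /u_ess [s su].
  rewrite -phiu -su phiZ scalerA (bigD1 i) //=.
  have -> : x i ^+ p.-1 = x i ^+ p.-2 * x i.
    by rewrite -exprSr; case: p p_gt1 {phiZ phiu x_nil} => [|[]].
  by rewrite -!mulrA mulrCA mulrC -scalerA xphi scaler0.
have xz_phi i n : (0 < n)%N -> x i ^+ n *: z = x i ^+ n *: phi z.
  case: n => // n _; apply/eqP; rewrite -subr_eq0 -scalerBr exprSr -scalerA.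
  by rewrite xw scaler0.
have [e] := x_nil z; elim: e => [|e IHe] xz.
  have i : 'I_d := Ordinal d_gt0.
  by apply: (x_kill i); rewrite -[x i]expr1 -xz_phi // -[1%N](expn0 p) xz.
apply: IHe => i; apply: phi_eq0.
by rewrite phiZ -exprM -expnSr -xz_phi ?xz // expn_gt0 ltnW.
Qed.

Section FrobeniusFunctor.
Variables (R : comNzRingType) (p : nat) (pcharRp : p \in [pchar R]).

Lemma FpureZ (M : lmodType R) (a : R) (z : M) :
  Fpure pcharRp (a *: z) = a ^+ p *: Fpure pcharRp z.
Proof.
by rewrite /Fpure (linearZ_LR (tensor1 (pFrobenius_aut pcharRp) (M := M))).
Qed.

Lemma FpureB (M : lmodType R) (y z : M) :
  Fpure pcharRp (y - z) = Fpure pcharRp y - Fpure pcharRp z.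
Proof. exact: (linearB (tensor1 (pFrobenius_aut pcharRp) (M := M))). Qed.

Lemma Fmap_pure (M N : lmodType R) (f : {linear M -> N}) z :
  Fmap pcharRp f (Fpure pcharRp z) = Fpure pcharRp (f z).
Proof. exact: ext_scalars_map1. Qed.

Lemma Fobj_sum (M : lmodType R) (w : Fobj pcharRp M) :
  exists s : seq (R * M), w = \sum_(u <- s) u.1 *: Fpure pcharRp u.2.
Proof. by have [s ->] := ext_scalars_repr w; exists s; apply: ext_scalars_sum. Qed.

(** In F(M), a^p (s (x) z) = s (x) a z. *)
Lemma Fobj_annihilated (M : lmodType R) (a : R) :
  (forall z : M, a *: z = 0) -> forall w : Fobj pcharRp M, a ^+ p *: w = 0.
Proof.
move=> aM w; have [s ->] := Fobj_sum w.
rewrite scaler_sumr big1_seq // => u _.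
rewrite scalerA mulrC -scalerA -FpureZ aM.
by rewrite -[X in Fpure _ X](subrr 0) FpureB subrr scaler0.
Qed.

Lemma Fiter_annihilated (M : lmodType R) (a : R) e :
  (forall z : M, a *: z = 0) ->
  forall w : Fiter pcharRp e M, a ^+ (p ^ e) *: w = 0.
Proof.
move=> aM; elim: e => [w|e IHe]; first by rewrite expn0 expr1; apply: aM.
by rewrite expnSr exprM; apply: Fobj_annihilated.
Qed.

Lemma Fmap_eq0 (M N : lmodType R) (f : {linear M -> N}) :
  (forall z, f z = 0) -> forall w, Fmap pcharRp f w = 0.
Proof.
move=> f0 w; have [s ->] := Fobj_sum w.
rewrite linear_sum big1_seq // => u _; rewrite linearZ /= Fmap_pure f0.
by rewrite -[X in Fpure _ X](subrr 0) FpureB subrr scaler0.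
Qed.

(** phi z is the image of 1 (x) z under the inverse of the structure map. *)
Lemma Frobenius_action (M : Fmodule pcharRp) :
  exists phi : M -> M, [/\ phi 0 = 0, forall a z, phi (a *: z) = a ^+ p *: phi z
    & forall z, Fstruct M (phi z) = Fpure pcharRp z].
Proof.
have [psi thetaK psiK] := Fstruct_bij M.
exists (fun z => psi (Fpure pcharRp z)); split=> [|a z|z]; last exact: psiK.
- rewrite -{1}[0](subrr (0 : M)) FpureB subrr.
  by rewrite -(linear0 (Fstruct M)) thetaK.
- by rewrite FpureZ -{1}(psiK (Fpure pcharRp z)) -linearZ thetaK.
Qed.

Lemma Fmap_comp (M N P : lmodType R) (f : {linear M -> N}) (g : {linear N -> P})
    (h : {linear M -> P}) :
  (forall z, h z = g (f z)) ->
  forall w, Fmap pcharRp g (Fmap pcharRp f w) = Fmap pcharRp h w.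
Proof. by move=> hE w; rewrite /Fmap -(ext_scalars_map_comp hE). Qed.

Section GeneratingMorphism.
Variables (M0 : lmodType R) (beta : {linear M0 -> Fobj pcharRp M0}).
Variables (M : Fmodule pcharRp) (i : forall e, {linear Fiter pcharRp e M0 -> M}).
Hypothesis i_lim : is_direct_limit (Fiter_map beta) i.
Hypothesis i_struct :
  forall e y, Fstruct M (i e y) = Fmap pcharRp (i e) (Fiter_map beta e y).

(** The structure isomorphism carries the (e+1)-st map of the cocone to F of the
    e-th, so all vanish as soon as the first one does. *)
Lemma generating_morphism_neq0 (z : M) : z != 0 -> exists y, i 0%N y != 0.
Proof.
move=> z0; apply: contrapT => i0.
have i_eq0 e y : i e y = 0.
  elim: e y => [|e IHe] y.
    by apply/eqP; apply: contra_notT i0 => iy; exists y.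
  apply: (bij_inj (Fstruct_bij M)); rewrite i_struct linear0 /=.
  rewrite (Fmap_comp (h := i e)) => [|w]; last by rewrite i_lim.1.
  exact: Fmap_eq0.
move: z0; apply/negP; rewrite negbK; apply/eqP.
apply: (direct_limit_ind (P := fun y => y = 0) i_lim) => //; split=> //.
- by move=> u v -> ->; rewrite addr0.
- by move=> a v ->; rewrite scaler0.
Qed.

Lemma generating_morphism_nilpotent (n : nat) (x : 'I_n -> R) :
  (forall j (y : M0), x j *: y = 0) ->
  forall z : M, exists e, forall j, x j ^+ (p ^ e) *: z = 0.
Proof.
move=> xM0; have p_gt0 : (0 < p)%N := prime_gt0 (pcharf_prime pcharRp).
have kill_le e f (a : R) (v : M) : (e <= f)%N ->
    a ^+ (p ^ e) *: v = 0 -> a ^+ (p ^ f) *: v = 0.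
  move=> /(leq_pexp2l p_gt0) /subnK <- av.
  by rewrite exprD -scalerA av scaler0.
apply: (direct_limit_ind i_lim) => [|e y]; last first.
  by exists e => j; rewrite -linearZ (Fiter_annihilated (xM0 j)) linear0.
split; first by exists 0%N => j; rewrite scaler0.
- move=> u v [e eu] [f fv]; exists (maxn e f) => j.
  rewrite scalerDr (kill_le e) ?leq_maxl // add0r.
  by rewrite (kill_le f) ?leq_maxr.
- by move=> a v [e ev]; exists e => j; rewrite scalerA mulrC -scalerA ev scaler0.
Qed.
End GeneratingMorphism.
End FrobeniusFunctor.

(** * Extensions of F-modules *)

Section TwistedExtension.
Variables (R : comNzRingType) (p : nat) (pcharRp : p \in [pchar R]).
Variables M N : Fmodule pcharRp.
Local Notation inl := (@inl_sum R p pcharRp M N).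
Local Notation inr := (@inr_sum R p pcharRp M N).

Section Twist.
Variable h : {linear M -> N}.

(** Up to equivalence, these structures on N (+) M give all the extensions of M
    by N whose underlying extension of modules splits. *)
Definition twisted_struct (u : N * M) : Fobj pcharRp (N * M)%type :=
  sum_struct (u.1 + h u.2, u.2).

Lemma twisted_struct_is_linear : linear twisted_struct.
Proof.
move=> a u v; rewrite /twisted_struct -linearP; congr sum_struct.
by congr (_, _); rewrite /= linearP scalerDr addrACA.
Qed.
HB.instance Definition _ := GRing.isLinear.Build R (N * M)%type
  (Fobj pcharRp (N * M)%type) *:%R twisted_struct twisted_struct_is_linear.

Lemma twisted_struct_bij : bijective twisted_struct.
Proof.
apply: (bij_comp (@sum_struct_bij _ _ _ M N)).
by exists (fun u => (u.1 - h u.2, u.2)) => -[y z] /=; rewrite ?addrK ?subrK.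
Qed.

Definition twisted_Fmodule : Fmodule pcharRp := FModule twisted_struct_bij.

Lemma twisted_inl_subproof y :
  twisted_struct (inl y) = Fmap pcharRp inl (Fstruct N y).
Proof. by rewrite /twisted_struct /= linear0 addr0 -sum_inl_subproof. Qed.
Definition twisted_inl : Fhom N twisted_Fmodule :=
  @FHom _ _ _ N twisted_Fmodule inl twisted_inl_subproof.

Lemma twisted_snd_subproof (u : N * M) :
  Fstruct M u.2 = Fmap pcharRp snd (twisted_struct u).
Proof. by rewrite Fmap_snd_sum. Qed.
Definition twisted_snd : Fhom twisted_Fmodule M :=
  @FHom _ _ _ twisted_Fmodule M snd twisted_snd_subproof.

Lemma twisted_inl_inj : injective twisted_inl.
Proof. by move=> y z []. Qed.

Lemma twisted_snd_surj y : exists u, twisted_snd u = y.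
Proof. by exists (0, y). Qed.

Lemma twisted_exact u : twisted_snd u = 0 <-> exists y, u = twisted_inl y.
Proof. by split=> [|[y ->] //]; case: u => y z /= ->; exists y. Qed.

Definition twisted_extension : extension M N :=
  Extension twisted_inl_inj twisted_snd_surj twisted_exact.
End Twist.

(** An equivalence f has the form (y, z) |-> (y + g z, z); the equation is the
    first coordinate of its compatibility with the structures at (0, z). *)
Lemma twisted_equiv (h k : {linear M -> N}) :
  ext_equiv (twisted_extension h) (twisted_extension k) ->
  exists g : {linear M -> N},
    forall z, Fstruct N (g z + k z - h z) = Fmap pcharRp g (Fstruct M z).
Proof.
case=> f [f_inl f_snd].
pose q : {linear (N * M)%type -> N} :=
  fst \o (f : {linear (N * M)%type -> (N * M)%type}).
exists (q \o inr) => z /=.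
have -> : q (inr z) + k z = (f (inr z)).1 + k (f (inr z)).2.
  by rewrite (f_snd (0, z) : (f (inr z)).2 = z).
rewrite linearB; apply/eqP; rewrite subr_eq; apply/eqP.
have /(congr1 (Fmap pcharRp fst)) := FhomP f (inr z).
rewrite Fmap_fst_sum [LHS]/= => ->.
rewrite (Fmap_comp (h := q)) // [Fstruct _ _]/= /twisted_struct /sum_struct.
rewrite [X in Fmap pcharRp q X]/= add0r [LHS]linearD.
rewrite (Fmap_comp (h := idfun)) => [|y]; last by rewrite /= f_inl.
by rewrite (Fmap_comp (h := q \o inr)) // /Fmap ext_scalars_map_id // addrC.
Qed.

(** A retraction of the inclusion of N, paired with the projection to M, is an
    equivalence with the split extension. *)
Lemma Finjective_Ext1 : Finjective N -> forall c : Ext1 M N, c = Ext1_zero M N.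
Proof.
move=> N_inj c; have [X ->] := Ext1_class_surj c; apply/Ext1_classP.
have [r rK] := N_inj _ _ _ (Fhom_id N) (@ext_inc_inj _ _ _ _ _ X).
pose f (w : ext_mid X) : N * M := (r w, ext_prj X w).
have f_lin : linear f by move=> a u v; rewrite /f !linearP.
pose fL : {linear ext_mid X -> (N * M)%type} :=
  HB.pack_for {linear ext_mid X -> (N * M)%type} f
    (GRing.isLinear.Build _ _ _ _ f f_lin).
have fP w : Fstruct (sum_Fmodule M N) (fL w) = Fmap pcharRp fL (Fstruct (ext_mid X) w).
  rewrite [LHS]/= /sum_struct [(fL w).1]/= [(fL w).2]/= !FhomP.
  rewrite (Fmap_comp (h := inl \o r)) // (Fmap_comp (h := inr \o ext_prj X)) //.
  rewrite /Fmap -(ext_scalars_mapD (h := fL)) // => y.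
  by congr (_, _); rewrite /= ?addr0 ?add0r.
exists (@FHom _ _ _ _ (sum_Fmodule M N) fL fP); split=> [y|w] //=.
rewrite /f rK; congr (_, _); apply/ext_exact; by exists y.
Qed.
End TwistedExtension.

(** * Extensions of R *)

Section ExtensionsOfR.
Variables (R : comNzRingType) (p : nat) (pcharRp : p \in [pchar R]).

Section ScaleBy.
Variables (V : lmodType R) (v : V).

Definition scale_by (r : R^o) : V := r *: v.

Lemma scale_by_is_linear : linear scale_by.
Proof. by move=> a r s; rewrite /scale_by scalerDl -scalerA. Qed.
HB.instance Definition _ :=
  GRing.isLinear.Build R R^o V *:%R scale_by scale_by_is_linear.
End ScaleBy.

Variable N : Fmodule pcharRp.

Definition extension_of_R (v : N) : extension (R_Fmodule pcharRp) N :=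
  @twisted_extension _ _ _ (R_Fmodule pcharRp) N (scale_by v).

Lemma extension_of_R_equiv (v w : N) :
  ext_equiv (extension_of_R v) (extension_of_R w) ->
  exists z, Fstruct N (z + w - v) = Fpure pcharRp z.
Proof.
move=> /twisted_equiv [g gP]; exists (g 1).
by have := gP 1; rewrite /= /R_struct scale1r Fmap_pure /scale_by !scale1r.
Qed.
End ExtensionsOfR.

Lemma infinite_inj (T U : Type) (x0 : T) (f : T -> U) :
  (forall x y, f x = f y -> x = y) -> infinite T -> infinite U.
Proof.
move=> f_inj T_inf [n [g g_surj]]; apply: T_inf.
have inv_g i : exists x, forall y, f y = g i -> x = y.
  have [[x xg]|no] := pselect (exists x, f x = g i).
    by exists x => y yg; apply: f_inj; rewrite xg.
  by exists x0 => y yg; case: no; exists y.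
have [h hP] := choice inv_g.
by exists n, h => y; have [i ig] := g_surj (f y); exists i; apply: hP.
Qed.

Theorem mainTheorem2
    (R : comNzRingType) (p d : nat) (pcharRp : p \in [pchar R])
    (m : idealr R) (R_regular : regular_local_ring m d) (d_ge1 : (1 <= d)%N)
    (* E is the injective hull of the residue field *)
    (E : Fmodule pcharRp) (iota : {linear {ideal_quot m} -> E})
    (E_hull : injective_hull iota)
    (* with its standard structure, for minimal generators x of m *)
    (x : 'I_d -> R) (x_gen : generates_ideal m x)
    (beta : {linear {ideal_quot m} -> Fobj pcharRp {ideal_quot m}})
    (beta_std : standard_generator x beta)
    (E_std : generating_morphism beta E) :
  (exists c : Ext1 (R_Fmodule pcharRp) E, c <> Ext1_zero (R_Fmodule pcharRp) E) /\
  (infinite {ideal_quot m} -> infinite (Ext1 (R_Fmodule pcharRp) E)) /\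
  ~ Finjective E.
Proof.
have [_ [m_max _] _ _] := R_regular; have [iota_inj iota_ess _] := E_hull.
have [i [i_lim i_struct]] := E_std.
have p_gt1 : (1 < p)%N := prime_gt1 (pcharf_prime pcharRp).
have xK j (k : {ideal_quot m}) : x j *: k = 0.
  rewrite -[k]ideal_quot_gen scalerA mulrC -scalerA ideal_quot_scaler1.
  apply/eqP; move: (generator_in_ideal j x_gen); rewrite -ideal_quot_eq0 => /eqP ->.
  by rewrite scaler0.
(* u generates the socle of E. *)
pose u : E := i 0%N (1 : {ideal_quot m}).
have u0 : u != 0.
  have iota1 : iota 1 != 0.
    by rewrite -(linear0 iota) (inj_eq iota_inj) oner_neq0.
  have [y] := generating_morphism_neq0 i_lim i_struct iota1.
  by apply: contraNneq => u0; rewrite -[y]ideal_quot_gen linearZ /= -/u u0 scaler0.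
have i0_inj := ideal_quot_linear_inj m_max u0.
have m_u a : a \in m -> a *: u = 0.
  move=> am; rewrite -linearZ /= ideal_quot_scaler1.
  by move: am; rewrite -ideal_quot_eq0 => /eqP ->; rewrite linear0.
have [phi [phi0 phiZ phiE]] := Frobenius_action E.
have phi_u : (\prod_j x j ^+ p.-1) *: phi u = u.
  apply: (bij_inj (Fstruct_bij E)).
  by rewrite linearZ /= phiE i_struct /= beta_std linearZ /= Fmap_pure.
(* The socle meets the image of 1 - phi only in 0. *)
have socle_inj (k : {ideal_quot m}) z : z - phi z = i 0%N k -> k = 0.
  move=> zk; apply: i0_inj; rewrite -zk.
  have -> : z = 0; last by rewrite phi0 subrr.
  apply: (sub_Frobenius_socle p_gt1 d_ge1 phi0 phiZ u0 _ phi_u).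
  - exact: essential_socle iota_ess u0 m_u.
  - apply: (generating_morphism_nilpotent i_lim); exact: xK.
  - by move=> j; rewrite zk -linearZ xK linear0.
pose c (k : {ideal_quot m}) : Ext1 (R_Fmodule pcharRp) E :=
  Ext1_class (extension_of_R (i 0%N k : E)).
have c_inj k l : c k = c l -> k = l.
  move=> /Ext1_classP /extension_of_R_equiv [z].
  rewrite -phiE => /(bij_inj (Fstruct_bij E)) zE.
  apply/eqP; rewrite -subr_eq0; apply/eqP; apply: (socle_inj _ z).
  by rewrite -zE opprB addrC opprD -addrA addrAC addNr add0r [RHS]linearB addrC.
have c_nonzero : exists e : Ext1 (R_Fmodule pcharRp) E,
    e <> Ext1_zero (R_Fmodule pcharRp) E.
  have [c0|] := pselect (c 0 = Ext1_zero (R_Fmodule pcharRp) E); last by exists (c 0).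
  exists (c 1); rewrite -c0 => /c_inj /eqP; exact/negP/oner_neq0.
split=> //; split; first exact: (infinite_inj (0 : {ideal_quot m}) c_inj).
by move=> E_inj; case: c_nonzero => e; apply; apply: Finjective_Ext1.
Qed.
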